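(* Let $X$ be a Boolean algebra and $\mu\colon X\to[0,1]_l$ a probability valuation on $X$. Then for every $x\in X$ the lower real $\mu(x)$ is a Dedekind real, i.e. for all rationals $q<r$ one has $q<\mu(x)$ or $\mu(x)\le r$ (constructively).
   Context: Reasoning is constructive (valid in any topos). $[0,1]_l$ denotes the lower reals in $[0,1]$: classically, lower cuts of rationals (downward closed, rounded sets of rationals); $\mu(x)$ being Dedekind means its lower cut is located. A probability valuation on a lattice $X$ is a monotone function $\mu\colon X\to[0,1]_l$ with $\mu(0)=0$, $\mu(1)=1$ and $\mu(x)+\mu(y)=\mu(x\wedge y)+\mu(x\vee y)$. *)

(* Defs.v *)
From Stdlib Require Export QArith.
Set Implicit Arguments.
Open Scope Q_scope.

(* Boolean algebras, stated axiomatically (no decidable equality assumed,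
   so this is valid in any topos). *)
Record BoolAlg := {
  car :> Type;
  bmeet : car -> car -> car;
  bjoin : car -> car -> car;
  bcompl : car -> car;
  bbot : car;
  btop : car;
  meetA : forall x y z, bmeet x (bmeet y z) = bmeet (bmeet x y) z;
  joinA : forall x y z, bjoin x (bjoin y z) = bjoin (bjoin x y) z;
  meetC : forall x y, bmeet x y = bmeet y x;
  joinC : forall x y, bjoin x y = bjoin y x;
  meet_absorb : forall x y, bmeet x (bjoin x y) = x;
  join_absorb : forall x y, bjoin x (bmeet x y) = x;
  meet_distr : forall x y z, bmeet x (bjoin y z) = bjoin (bmeet x y) (bmeet x z);
  meet_top : forall x, bmeet x btop = x;
  join_bot : forall x, bjoin x bbot = x;
  meet_compl : forall x, bmeet x (bcompl x) = bbot;
  join_compl : forall x, bjoin x (bcompl x) = btop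
}.

Arguments bmeet {_}. Arguments bjoin {_}. Arguments bcompl {_}.
Definition ble {X : BoolAlg} (x y : X) : Prop := bmeet x y = x.

Record lreal01 := {
  lcut : Q -> Prop;
  lcut_down : forall q r, q <= r -> lcut r -> lcut q;
  lcut_round : forall q, lcut q -> exists r, q < r /\ lcut r;
  lcut_ge0 : forall q, q < 0 -> lcut q;
  lcut_le1 : forall q, lcut q -> q < 1
}.

Definition lsum (a b : lreal01) (q : Q) : Prop :=
  exists s t, lcut a s /\ lcut b t /\ q < s + t.

Definition prob_valuation {X : BoolAlg} (mu : X -> lreal01) : Prop :=
  (forall x y : X, ble x y -> forall q, lcut (mu x) q -> lcut (mu y) q) /\
  (forall q, lcut (mu (bbot X)) q <-> q < 0) /\
  (forall q, lcut (mu (btop X)) q <-> q < 1) /\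
  (forall x y : X, forall q,
      lsum (mu x) (mu y) q <-> lsum (mu (bmeet x y)) (mu (bjoin x y)) q).

(* A lower real is Dedekind (its cut is located). "a <= r" means every
   element of the cut is < r. *)
Definition dedekind (a : lreal01) : Prop :=
  forall q r : Q, q < r -> lcut a q \/ (forall s, lcut a s -> s < r).

(* Main.v *)
Require Import Defs.
From Stdlib Require Import Lqa.

(* In a Boolean algebra, [x /\ ~x = 0] and [x \/ ~x = 1], so the
   modular law of a probability valuation says that the lower reals
   [mu x] and [mu (~x)] add up exactly to 1.  Two lower reals [a], [b] whose
   sum is exactly 1 are both located: given rationals [q < r], approximate
   the sum 1 within [r - q] by [s + t] with [s] in the cut of [a] and [t] in
   the cut of [b]; either [q < s], so [q] is in the cut of [a], or [s <= q],
   and then every [u] in the cut of [a] satisfies [u + t < 1], whence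
   [u < 1 - t < s + (r - q) <= r]. *)

Definition sums_to_one (a b : lreal01) : Prop :=
  forall p, lsum a b p <-> p < 1.

Lemma sums_to_one_zero_one (a b : lreal01) :
  (forall q, lcut a q <-> q < 0) -> (forall q, lcut b q <-> q < 1) ->
  sums_to_one a b.
Proof.
  intros Ha Hb p; split.
  - intros [s [t [Hs [Ht Hp]]]].
    apply Ha in Hs; apply Hb in Ht; lra.
  - intro Hp.
    exists ((p - 1) * (1 # 4)), ((p + 1) * (1 # 2)).
    split; [apply Ha; lra | split; [apply Hb; lra | lra]].
Qed.

(* A probability valuation gives complementary elements complementary
   measures: [mu x + mu (~x) = mu 0 + mu 1 = 1]. *)
Lemma valuation_compl_sums_to_one {X : BoolAlg} {mu : X -> lreal01} :
  prob_valuation mu -> forall x : X, sums_to_one (mu x) (mu (bcompl x)).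
Proof.
  intros [_ [Hbot [Htop Hmod]]] x p.
  rewrite Hmod, meet_compl, join_compl.
  exact (sums_to_one_zero_one _ _ Hbot Htop p).
Qed.

Lemma sums_to_one_dedekind (a b : lreal01) :
  sums_to_one a b -> dedekind a.
Proof.
  intros Hsum q r Hqr.
  (* Elements of the two cuts always sum to less than 1 (by roundedness). *)
  assert (Hbound : forall u t, lcut a u -> lcut b t -> u + t < 1).
  { intros u t Hu Ht.
    destruct (lcut_round a u Hu) as [u' [Hu' Hu'a]].
    apply Hsum; exists u', t; split; [exact Hu'a | split; [exact Ht | lra]]. }
  assert (Happrox : exists s t, lcut a s /\ lcut b t /\ 1 - (r - q) < s + t).
  { apply Hsum; lra. }
  destruct Happrox as [s [t [Hs [Ht Hst]]]].
  destruct (Qlt_le_dec q s) as [Hqs | Hsq].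
  - left; exact (lcut_down a (Qlt_le_weak _ _ Hqs) Hs).
  - right; intros u Hu.
    pose proof (Hbound u t Hu Ht); lra.
Qed.

Theorem lemma6 (X : BoolAlg) (mu : X -> lreal01) (Hmu : prob_valuation mu) :
  forall x : X, dedekind (mu x).
Proof.
  intro x.
  apply (sums_to_one_dedekind (mu x) (mu (bcompl x))).
  exact (valuation_compl_sums_to_one Hmu x).
Qed.
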